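(* For any connected graph $G=(V,E)$ of order $n\ge 2$ and size $m$, the edge coalition number satisfies $$1\le EC(G)\le m\le \frac{n(n-1)}{2}.$$
   Context: Graphs are finite and simple; the order is the number of vertices and the size is the number of edges. Two distinct edges are adjacent if they share an endpoint. A set $D\subseteq E$ is an edge-dominating set of $G=(V,E)$ if every edge in $E\setminus D$ is adjacent to an edge of $D$. Two disjoint sets of edges $E_1,E_2$ form an edge coalition if neither is an edge-dominating set but $E_1\cup E_2$ is. An $ec$-partition of $G$ is a partition $\pi=\{E_1,\ldots,E_k\}$ of $E$ into nonempty sets such that every $E_i$ is either a singleton edge-dominating set, or is not an edge-dominating set but forms an edge coalition with another set $E_j$ of $\pi$. The edge coalition number $EC(G)$ is the maximum order $k$ of an $ec$-partition of $G$. *)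

(* Defs.v *)
From HB Require Import structures.
From mathcomp Require Import all_boot.

Set Implicit Arguments.
Unset Strict Implicit.
Unset Printing Implicit Defensive.

(* A finite simple graph is a symmetric irreflexive relation [adj] on a
   finType [V]; an edge is the two-element set of its endpoints. *)
Definition edges (V : finType) (adj : rel V) : {set {set V}} :=
  [set f : {set V} | [exists x, exists y, adj x y && (f == [set x; y])]].

Definition connected_graph (V : finType) (adj : rel V) : bool :=
  [forall x, forall y, connect adj x y].

Definition adjacent_edges (V : finType) (f g : {set V}) : bool :=
  (f != g) && (f :&: g != set0).

Definition edge_dominating (V : finType) (adj : rel V)
    (D : {set {set V}}) : bool :=
  (D \subset edges adj) &&
  [forall f in edges adj :\: D, [exists g in D, adjacent_edges f g]].

Definition edge_coalition (V : finType) (adj : rel V)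
    (A B : {set {set V}}) : bool :=
  [&& A \subset edges adj, B \subset edges adj, [disjoint A & B],
      ~~ edge_dominating adj A, ~~ edge_dominating adj B
    & edge_dominating adj (A :|: B)].

Definition ec_partition (V : finType) (adj : rel V)
    (P : {set {set {set V}}}) : bool :=
  partition P (edges adj) &&
  [forall A in P,
     ((#|A| == 1) && edge_dominating adj A)
     || (~~ edge_dominating adj A
         && [exists B in P, (B != A) && edge_coalition adj A B])].

(* The maximum over an empty family is 0, whereas an ec-partition of a graph
   with an edge has at least one block: for such a graph, [0 < EC adj] holds
   exactly when an ec-partition exists. *)
Definition EC (V : finType) (adj : rel V) : nat :=
  \max_(P : {set {set {set V}}} | ec_partition adj P) #|P|.

(* Main.v *)
Require Import Defs.
From HB Require Import structures.
From mathcomp Require Import all_boot.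

Set Implicit Arguments.
Unset Strict Implicit.
Unset Printing Implicit Defensive.

(** The upper bounds are counting: the blocks of a partition of the edge set
    are nonempty, and edges are two-element sets of vertices.  The content of
    the lower bound is that an ec-partition exists at all; it then has a block,
    as a connected graph with two vertices has an edge.

    Call a set of edges admissible when it is a single edge or is not
    edge-dominating.  The partition of the edge set into single edges has
    admissible blocks, so there is a partition [P] into admissible blocks with
    the least number of blocks; it is an ec-partition
    ([ec_partition_of_minimal]).  Indeed a dominating block is a single edge.
    Let [A] be a non-dominating block.  If [B] is another non-dominating block,
    then [A :|: B] must be dominating, since otherwise merging [A] and [B]
    would give fewer admissible blocks; so [A] and [B] form an edge coalition.
    If there is no such [B], then every edge outside [A] is by itself a
    dominating set, hence adjacent to every edge of [A]; as [A] is nonempty,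
    [A] would be dominating, a contradiction. *)

Lemma card_partition_le (T : finType) (P : {set {set T}}) (D : {set T}) :
  partition P D -> #|P| <= #|D|.
Proof.
move=> partP; rewrite (card_partition partP) -sum1_card.
by apply: leq_sum => A AP; rewrite card_gt0 (partition_neq0 partP AP).
Qed.

Lemma partition_singletons (T : finType) (D : {set T}) :
  partition [set [set x] | x in D] D.
Proof.
suff -> : [set [set x] | x in D] = preim_partition id D.
  exact: preim_partitionP.
apply: eq_in_imset => x xD; apply/setP => y; rewrite !inE /= eq_sym.
by case: eqP => [<-|]; rewrite ?xD ?andbF.
Qed.

Lemma partition_merge (T : finType) (P : {set {set T}}) (D A B : {set T}) :
  partition P D -> A \in P -> B \in P -> B != A ->
  partition ((A :|: B) |: (P :\ A :\ B)) D.
Proof.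
move=> partP AP BP neqBA.
have BPA : B \in P :\ A by rewrite !inE neqBA.
have partAB := partitionD1 (partitionD1 partP AP) BPA.
have subABD : A :|: B \subset D.
  by rewrite subUset (partitionS partP AP) (partitionS partP BP).
have defD : D = (A :|: B) :|: (D :\: A :\: B).
  by rewrite setDDl -{1}(setID D (A :|: B)) (setIidPr subABD).
rewrite [X in partition _ X]defD; apply: partitionU1 => //.
  by rewrite setU_eq0 negb_and (partition_neq0 partP AP).
by rewrite setDDl -setI_eq0 setIDA setIC -setIDA setDv setI0.
Qed.

Lemma card_merge_lt (T : finType) (P : {set {set T}}) (A B : {set T}) :
  A \in P -> B \in P -> B != A ->
  #|(A :|: B) |: (P :\ A :\ B)| < #|P|.
Proof.
move=> AP BP neqBA.
have BPA : B \in P :\ A by rewrite !inE neqBA.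
rewrite (cardsD1 A P) AP (cardsD1 B (P :\ A)) BPA cardsU1 !add1n ltnS.
by rewrite -add1n leq_add2r leq_b1.
Qed.

Lemma card_edges_le (V : finType) (adj : rel V) :
  irreflexive adj -> #|edges adj| <= 'C(#|V|, 2).
Proof.
move=> adj_irr; rewrite -card_draws; apply/subset_leq_card/subsetP => f.
rewrite !inE => /existsP[x /existsP[y /andP[xy /eqP->]]].
have neqxy : x != y by apply: contraTneq xy => ->; rewrite adj_irr.
by rewrite cards2 neqxy.
Qed.

Lemma edges_neq0 (V : finType) (adj : rel V) :
  connected_graph adj -> 1 < #|V| -> edges adj != set0.
Proof.
move=> /forallP conn /card_gt1P[x [y [_ _ neqxy]]].
have /forallP/(_ y)/connectP[[|z p] /= path_p lastp] := conn x.
  by rewrite lastp eqxx in neqxy.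
have /andP[xz _] := path_p.
apply/set0Pn; exists [set x; z].
by rewrite inE; apply/existsP; exists x; apply/existsP; exists z; rewrite xz /=.
Qed.

Lemma adjacent_edges_sym (V : finType) : symmetric (@adjacent_edges V).
Proof. by move=> f g; rewrite /adjacent_edges eq_sym setIC. Qed.

(** The relaxation of the ec-partition condition that is satisfied by the
    singletons and survives merging two blocks with a non-dominating union. *)
Definition admissible_partition (V : finType) (adj : rel V)
    (P : {set {set {set V}}}) : bool :=
  partition P (edges adj) &&
  [forall A in P, (#|A| == 1) || ~~ edge_dominating adj A].

Lemma admissible_singletons (V : finType) (adj : rel V) :
  admissible_partition adj [set [set f] | f in edges adj].
Proof.
rewrite /admissible_partition partition_singletons.
by apply/forall_inP => _ /imsetP[f _ ->]; rewrite cards1.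
Qed.

Lemma admissible_merge (V : finType) (adj : rel V)
    (P : {set {set {set V}}}) (A B : {set {set V}}) :
  admissible_partition adj P -> A \in P -> B \in P -> B != A ->
  ~~ edge_dominating adj (A :|: B) ->
  admissible_partition adj ((A :|: B) |: (P :\ A :\ B)).
Proof.
move=> /andP[partP /forall_inP admP] AP BP neqBA ndomAB.
rewrite /admissible_partition partition_merge //=.
apply/forall_inP => C /setU1P[->|/setD1P[_ /setD1P[_ CP]]].
  by rewrite ndomAB orbT.
exact: admP.
Qed.

(** A dominating singleton outside [A] is adjacent to all edges of [A], so [A]
    dominates it in turn; hence some block other than [A] is not a dominating
    singleton. *)
Lemma other_nondominating_block (V : finType) (adj : rel V)
    (P : {set {set {set V}}}) (A : {set {set V}}) :
  admissible_partition adj P -> A \in P -> ~~ edge_dominating adj A ->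
  exists B, [/\ B \in P, B != A & ~~ edge_dominating adj B].
Proof.
move=> /andP[partP /forall_inP admP] AP ndomA.
case: (pickP [pred B | [&& B \in P, B != A & ~~ edge_dominating adj B]]).
  by move=> B /and3P[BP neqBA ndomB]; exists B.
move=> no_other; case/negP: ndomA.
rewrite /edge_dominating (partitionS partP AP) /=.
apply/forall_inP => f /setDP[fE fA].
have [B BP fB] : exists2 B, B \in P & f \in B.
  by apply/bigcupP; rewrite -/(cover P) (cover_partition partP).
have neqBA : B != A by apply: contraNneq fA => <-.
have domB : edge_dominating adj B.
  by move: (no_other B); rewrite /= BP neqBA /= => /negbFE.
have /cards1P[f' defB] : #|B| == 1 by move: (admP B BP); rewrite domB orbF.
move: fB; rewrite defB inE => /eqP eqff'; rewrite -{f'}eqff' in defB.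
have /set0Pn[g gA] := partition_neq0 partP AP.
apply/exists_inP; exists g => //; rewrite adjacent_edges_sym.
have gEB : g \in edges adj :\: B.
  rewrite inE (subsetP (partitionS partP AP) g gA) andbT defB inE.
  by apply: contraNneq fA => <-.
have /andP[_ /forall_inP/(_ g gEB)/exists_inP[h]] := domB.
by rewrite defB inE => /eqP->.
Qed.

(** Minimality makes the union of any two distinct blocks dominating: a
    non-dominating union could replace them in an admissible partition with
    one block fewer.  So any two non-dominating blocks are coalition partners. *)
Lemma ec_partition_of_minimal (V : finType) (adj : rel V)
    (P : {set {set {set V}}}) :
  admissible_partition adj P ->
  (forall Q, admissible_partition adj Q -> #|P| <= #|Q|) ->
  ec_partition adj P.
Proof.
move=> adm_P minP; have /andP[partP /forall_inP admP] := adm_P.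
rewrite /ec_partition partP; apply/forall_inP => A AP.
have [domA|ndomA] /= := boolP (edge_dominating adj A).
  by move: (admP A AP); rewrite domA !orbF andbT.
rewrite andbF /=.
have [B [BP neqBA ndomB]] := other_nondominating_block adm_P AP ndomA.
apply/exists_inP; exists B => //; rewrite neqBA /edge_coalition.
rewrite !(partitionS partP) // ndomA ndomB /=; apply/andP; split.
  by apply: (trivIsetP (partition_trivIset partP)) => //; rewrite eq_sym.
apply: contraLR (card_merge_lt AP BP neqBA) => ndomAB.
by rewrite -leqNgt; apply: minP; apply: admissible_merge.
Qed.

Lemma exists_ec_partition (V : finType) (adj : rel V) :
  exists P, ec_partition adj P.
Proof.
have [P admP minP] :=
  arg_minnP (fun P : {set {set {set V}}} => #|P|) (admissible_singletons adj).
by exists P; apply: ec_partition_of_minimal.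
Qed.

Lemma EC_gt0 (V : finType) (adj : rel V) : edges adj != set0 -> 0 < EC adj.
Proof.
move=> E_neq0; have [P ecP] := exists_ec_partition adj.
apply: (bigmax_sup P) => //.
have /andP[partP _] := ecP.
rewrite card_gt0; apply: contraNneq E_neq0 => P0.
by rewrite -(cover_partition partP) P0 /cover big_set0.
Qed.

Lemma EC_le_size (V : finType) (adj : rel V) : EC adj <= #|edges adj|.
Proof. by apply/bigmax_leqP => P /andP[/card_partition_le]. Qed.

Theorem corollary4p5 (V : finType) (adj : rel V)
    (adj_sym : symmetric adj) (adj_irr : irreflexive adj)
    (adj_conn : connected_graph adj) (n m : nat)
    (order_n : #|V| = n) (size_m : #|edges adj| = m) (n_ge2 : 2 <= n) :
  [/\ 1 <= EC adj, EC adj <= m & m <= (n * (n - 1)) %/ 2].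
Proof.
subst n m; split; first exact: EC_gt0 (edges_neq0 adj_conn n_ge2).
  exact: EC_le_size.
by rewrite divn2 subn1 -bin2 card_edges_le.
Qed.
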